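(* Let $\mathcal A,\mathcal B,\mathcal S$ be finite sets and let $p_s(a,b)$, $s\in\mathcal S$, be probability distributions on $\mathcal A\times\mathcal B$. Let $\bar{\mathcal G}$ be the bipartite graph on $\mathcal A\sqcup\mathcal B$ with an edge between $a$ and $b$ iff $p_s(a,b)>0$ for some $s\in\mathcal S$. Let $\mathcal C$ be the set of connected components of $\bar{\mathcal G}$. Define the common data $C\in\mathcal C$ of an outcome $(A,B)$ as the connected component containing $A$, which is also the one containing $B$. Let $p_s(a,b,c)$ be the induced joint distribution of $(A,B,C)$ when $(A,B)\sim p_s$. Suppose there is no non-zero function $\psi:\mathcal C\to\mathbb R$ such that $\mathbb E_{(s)}[\psi(C)]=0$ for all $s\in\mathcal S$, where the expectation is with respect to $p_s$. Then common randomness cannot be extracted from the distributed SV source with respect to $\{p_s\}$.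
   Context: Distributed SV source with respect to $\{p_s\}$: at each step $i$ an adversary chooses $S_i=s_i\in\mathcal S$, possibly randomly, depending on the previous outcomes $(A_1,B_1),\dots,(A_{i-1},B_{i-1})$; then $(A_i,B_i)$ is sampled from $p_{s_i}$. Alice receives $A_1,A_2,\dots$ and Bob receives $B_1,B_2,\dots$. Common randomness can be extracted if for every $\epsilon>0$ there exist $n$ and functions $\Gamma_n:\mathcal A^n\to\{0,1\}$, $\Lambda_n:\mathcal B^n\to\{0,1\}$ such that, for every adversary strategy, $K_1=\Gamma_n(A^n)$ and $K_2=\Lambda_n(B^n)$ are each $\epsilon$-close in total variation distance to uniform on $\{0,1\}$, and $\Pr[K_1\neq K_2]<\epsilon$. *)

(* Defs.v *)
From HB Require Import structures.
From mathcomp Require Import all_boot all_order all_algebra.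
From mathcomp Require Import reals.

Set Implicit Arguments.
Unset Strict Implicit.
Unset Printing Implicit Defensive.
Import Order.TTheory GRing.Theory Num.Theory.
Local Open Scope ring_scope.

Record fdist (R : realType) (T : finType) := FDist {
  fdist_fun :> T -> R;
  fdist_ge0 : forall x, 0 <= fdist_fun x;
  fdist_sum1 : \sum_x fdist_fun x = 1 }.

Section FiniteProbability.
Variables (R : realType) (T : finType).

Definition Pr (P : fdist R T) (E : pred T) : R := \sum_(x | E x) P x.

Definition Expect (P : fdist R T) (f : T -> R) : R := \sum_x P x * f x.

Definition tv_dist (P Q : T -> R) : R := 2^-1 * \sum_x `|P x - Q x|.

Definition law (P : fdist R T) (U : finType) (X : T -> U) : U -> R :=
  fun u => Pr P (fun x => X x == u).

End FiniteProbability.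

Definition uniform_bit (R : realType) : bool -> R := fun=> 2^-1.

Section CommonData.
Variables (R : realType) (A B S : finType) (p : S -> fdist R (A * B)%type).

Definition edge : rel (A + B) := fun u v =>
  match u, v with
  | inl a, inr b | inr b, inl a => [exists s, 0 < p s (a, b)]
  | _, _ => false
  end.

Definition component_of (v : A + B) : {set A + B} :=
  [set w | connect edge v w].

Definition components : {set {set A + B}} :=
  [set component_of v | v : A + B].

Definition component := {c : {set A + B} | c \in components}.

Lemma component_of_in (v : A + B) : component_of v \in components.
Proof. exact: imset_f. Qed.

Definition component_at (v : A + B) : component :=
  exist _ (component_of v) (component_of_in v).

Definition common_data (o : A * B) : component := component_at (inl o.1).

Lemma edge_sym : symmetric edge.
Proof. by case=> [a|b] [a'|b']. Qed.

Lemma common_dataE (s : S) (o : A * B) :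
  0 < p s o -> common_data o = component_at (inr o.2).
Proof.
case: o => a b po; apply: val_inj; apply/setP => w; rewrite !inE.
apply: (same_connect (sym_connect_sym edge_sym)).
by apply: connect1; apply/existsP; exists s.
Qed.

End CommonData.

Section DistributedSV.
Variables (R : realType) (A B S : finType) (p : S -> fdist R (A * B)%type).

(* Given the history [:: (A_1, B_1); ...; (A_(i-1), B_(i-1))], the conditional
   distribution of S_i. *)
Definition strategy := seq (A * B) -> fdist R S.

(* Probability that, after the history h, the next n steps (S_i, (A_i, B_i))
   are w. *)
Definition path_weight (q : strategy) (h : seq (A * B)) (n : nat)
    (w : n.-tuple (S * (A * B))) : R :=
  \prod_(i < n)
    (q (h ++ take i (map snd w)) (tnth w i).1 * p (tnth w i).1 (tnth w i).2).

Lemma path_weight_ge0 q h n (w : n.-tuple (S * (A * B))) :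
  0 <= path_weight q h w.
Proof. by apply: prodr_ge0 => i _; apply: mulr_ge0; apply: fdist_ge0. Qed.

Lemma path_weight_cons q h n x (w : n.-tuple (S * (A * B))) :
  path_weight q h [tuple of x :: w] =
  q h x.1 * p x.1 x.2 * path_weight q (rcons h x.2) w.
Proof.
rewrite /path_weight big_ord_recl /= cats0; congr (_ * _).
by apply: eq_bigr => i _; rewrite tnthS -cat_rcons.
Qed.

Lemma path_weight_sum1 q h n :
  \sum_(w : n.-tuple (S * (A * B))) path_weight q h w = 1.
Proof.
elim: n h => [|n IHn] h.
  rewrite (big_pred1 [tuple]) => [|w]; last by apply/esym/eqP; exact: tuple0.
  by rewrite /path_weight big_ord0.
pose cons_t (xw : (S * (A * B)) * n.-tuple (S * (A * B))) :=
  [tuple of xw.1 :: xw.2].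
pose uncons_t (w : n.+1.-tuple (S * (A * B))) := (thead w, behead_tuple w).
rewrite (reindex cons_t) /=; last first.
  apply: onW_bij; exists uncons_t => [[x w]|w].
    by congr pair; apply: val_inj.
  by rewrite [RHS]tuple_eta; apply: val_inj.
rewrite -(pair_bigA _ (fun x w => path_weight q h (cons_t (x, w)))) /=.
transitivity (\sum_x q h x.1 * p x.1 x.2).
  apply: eq_bigr => x _; rewrite -[RHS]mulr1 -(IHn (rcons h x.2)) mulr_sumr.
  by apply: eq_bigr => w _; rewrite path_weight_cons.
rewrite -(pair_bigA _ (fun s o => q h s * p s o)) /= -[RHS](fdist_sum1 (q h)).
by apply: eq_bigr => s _; rewrite -mulr_sumr fdist_sum1 mulr1.
Qed.

(* Joint law of the first n triples (S_i, (A_i, B_i)). *)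
Definition source_law (q : strategy) (n : nat) :
    fdist R (n.-tuple (S * (A * B))) :=
  FDist (path_weight_ge0 q [::] (n := n)) (path_weight_sum1 q [::] n).

Definition alice_view n (w : n.-tuple (S * (A * B))) : n.-tuple A :=
  map_tuple (fun x => x.2.1) w.

Definition bob_view n (w : n.-tuple (S * (A * B))) : n.-tuple B :=
  map_tuple (fun x => x.2.2) w.

Definition common_randomness_extractable : Prop :=
  forall eps : R, 0 < eps ->
  exists (n : nat) (Gamma : n.-tuple A -> bool) (Lambda : n.-tuple B -> bool),
  forall q : strategy,
    let P := source_law q n in
    let K1 := fun w => Gamma (alice_view w) in
    let K2 := fun w => Lambda (bob_view w) in
    [/\ tv_dist (law P K1) (uniform_bit R) <= eps,
        tv_dist (law P K2) (uniform_bit R) <= eps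
      & Pr P (fun w => K1 w != K2 w) < eps].

End DistributedSV.

(* Main.v *)
Require Import Defs.
From HB Require Import structures.
From mathcomp Require Import all_boot all_order all_algebra.
From mathcomp Require Import reals ring lra.

Set Implicit Arguments.
Unset Strict Implicit.
Unset Printing Implicit Defensive.
Import Order.TTheory GRing.Theory Num.Theory.
Local Open Scope ring_scope.

(* Let x and y be the probabilities that Alice's and Bob's bits are 1 when every
   S_i is drawn uniformly, and put u = (x + y) / 2.  By induction on n, some
   adversary q satisfies
     E_q[(K1 + K2) / 2 + (k + K) * [K1 <> K2]] >= u + k u (1 - u) + K (x - y)^2,
   which for u near 1/2 contradicts extraction.  The induction step is a
   one-round inequality: passing to the first outcome (a, b) costs k times the
   variance of (x_a + y_b) / 2, which must be paid either by K times the variance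
   of x_a - y_b, or by a choice of s with E_s[(x_a + y_b) / 2] above average.
   If both payments vanish, then (x_a + y_b) / 2 is a function of C with the same
   mean under all p_s, hence constant; by linearity this kernel inclusion becomes
   the quantitative estimate dev_bound. *)

(** * Linear functionals, and maxima over finite types *)

(** [G] vanishes on the kernel of the joint map sending [z] to the family of all [F j z], so it
    factors through that map; the coefficients are the values of the factor on the standard
    basis. *)
Lemma scalar_comb_of_ker (K : fieldType) (V : vectType K) (J : finType)
    (F : J -> V -> K) (G : V -> K) :
  (forall j, scalar (F j)) -> scalar G ->
  (forall z, (forall j, F j z = 0) -> G z = 0) ->
  exists c : J -> K, forall z, G z = \sum_j c j * F j z.
Proof.
move=> Flin Glin kerFG.
pose T (z : V) : {ffun J -> K^o} := [ffun j => F j z].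
have Tlin : linear T by move=> a u v; apply/ffunP => j; rewrite !ffunE Flin.
pose TL : {linear V -> {ffun J -> K^o}} :=
  HB.pack T (GRing.isLinear.Build _ _ _ _ T Tlin).
pose GL : {scalar V} := HB.pack G (GRing.isLinear.Build _ _ _ _ G Glin).
pose t := linfun TL.
pose H := fun y => GL ((t^-1)%VF y).
exists (fun j => H [ffun i => (i == j)%:R]) => z.
(* The pseudo-inverse preserves images under [t], so [z] and [t^-1 (t z)] differ by an element of
   the common kernel of the [F j], where [G] vanishes. *)
have -> : G z = H (t z).
  apply/eqP; rewrite /H -subr_eq0 -[G z]/(GL z) -linearB; apply/eqP/kerFG => j.
  have tz : t (z - (t^-1)%VF (t z)) = 0.
    by rewrite linearB /= limg_lfunVK ?subrr // memv_img ?memvf.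
  by move/ffunP: tz => /(_ j); rewrite lfunE !ffunE.
have {1}-> : t z = \sum_j F j z *: [ffun i => (i == j)%:R].
  apply/ffunP => i; rewrite lfunE sum_ffunE ffunE (bigD1 i) //= !ffunE eqxx.
  rewrite big1 ?addr0 => [|j ji]; first by rewrite /GRing.scale /= mulr1.
  by rewrite !ffunE eq_sym (negPf ji) scaler0.
rewrite /H !linear_sum; apply: eq_bigr => j _.
by rewrite !linearZ /= mulrC.
Qed.

Lemma exists_max (R : realType) (T : finType) (f : T -> R) :
  (0 < #|T|)%N -> exists x, forall y, f y <= f x.
Proof.
move/card_gt0P => [x0 _]; exists [arg max_(x > x0) f x]%O.
by case: arg_maxP => // x _ fx y; apply: fx.
Qed.

(** * Expectation under a finite distribution *)

Section Expectation.
Variables (R : realType) (T : finType) (P : fdist R T).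
Implicit Types f g : T -> R.

Lemma eq_Expect f g : (forall x, P x != 0 -> f x = g x) ->
  Expect P f = Expect P g.
Proof.
move=> fg; apply: eq_bigr => x _.
by have [->|/fg->//] := eqVneq (P x) 0; rewrite !mul0r.
Qed.

Lemma ExpectD f g : Expect P (fun x => f x + g x) = Expect P f + Expect P g.
Proof. by rewrite -big_split; apply: eq_bigr => x _; rewrite mulrDr. Qed.

Lemma ExpectZ c f : Expect P (fun x => c * f x) = c * Expect P f.
Proof. by rewrite mulr_sumr; apply: eq_bigr => x _; rewrite mulrCA. Qed.

Lemma Expect_cst c : Expect P (fun=> c) = c.
Proof. by rewrite /Expect -mulr_suml fdist_sum1 mul1r. Qed.

Lemma Expect_le f g : (forall x, P x != 0 -> f x <= g x) ->
  Expect P f <= Expect P g.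
Proof.
move=> fg; apply: ler_sum => x _.
have [->|/fg fgx] := eqVneq (P x) 0; first by rewrite !mul0r.
by rewrite ler_wpM2l ?fdist_ge0.
Qed.

Lemma Expect_ge0 f : (forall x, 0 <= f x) -> 0 <= Expect P f.
Proof. by move=> f0; apply: sumr_ge0 => x _; rewrite mulr_ge0 ?fdist_ge0. Qed.

Lemma normr_Expect f : `|Expect P f| <= Expect P (fun x => `|f x|).
Proof.
apply: le_trans (ler_norm_sum _ _ _) _; apply: ler_sum => x _.
by rewrite normrM ger0_norm ?fdist_ge0.
Qed.

Lemma Expect_quad f a b c :
  Expect P (fun x => a + b * f x + c * f x ^+ 2) =
  a + b * Expect P f + c * Expect P (fun x => f x ^+ 2).
Proof. by rewrite !ExpectD !ExpectZ Expect_cst. Qed.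

(** The centre [c] is arbitrary because second moments under a single [p s] are later taken around
    the mean of the mixture. *)
Lemma Expect_sqr_dev f c :
  Expect P (fun x => f x ^+ 2) =
  Expect P (fun x => (f x - c) ^+ 2) + 2 * c * Expect P f - c ^+ 2.
Proof.
have -> : Expect P (fun x => (f x - c) ^+ 2) =
    Expect P (fun x => c ^+ 2 + (- 2 * c) * f x + 1 * f x ^+ 2).
  by apply: eq_Expect => x _; ring.
by rewrite Expect_quad; ring.
Qed.

Lemma Expect_sqr_ge f : Expect P f ^+ 2 <= Expect P (fun x => f x ^+ 2).
Proof.
rewrite (Expect_sqr_dev f (Expect P f)).
have : 0 <= Expect P (fun x => (f x - Expect P f) ^+ 2).
  by apply: Expect_ge0 => x; apply: sqr_ge0.
by rewrite expr2; lra.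
Qed.

Lemma exists_ge_Expect f : exists x, Expect P f <= f x.
Proof.
have [x xmax] : exists x, forall y, f y <= f x.
  apply: exists_max; rewrite lt0n; apply/eqP => T0.
  have := fdist_sum1 P; rewrite big1 => [/esym/eqP|x _]; first by rewrite oner_eq0.
  by have := card0_eq T0 x; rewrite inE.
by exists x; rewrite -[leRHS]Expect_cst; apply: Expect_le.
Qed.

End Expectation.

(** * Mixtures, point masses and the uniform distribution *)

Definition mixture_fun (R : realType) (S T : finType) (P : fdist R S)
  (p : S -> fdist R T) (x : T) : R := Expect P (fun s => p s x).

Lemma mixture_ge0 (R : realType) (S T : finType) (P : fdist R S)
  (p : S -> fdist R T) x : 0 <= mixture_fun P p x.
Proof. by apply: Expect_ge0 => s; apply: fdist_ge0. Qed.

Lemma mixture_sum1 (R : realType) (S T : finType) (P : fdist R S)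
  (p : S -> fdist R T) : \sum_x mixture_fun P p x = 1.
Proof.
rewrite exchange_big -[RHS](fdist_sum1 P); apply: eq_bigr => s _.
by rewrite -mulr_sumr fdist_sum1 mulr1.
Qed.

Definition mixture (R : realType) (S T : finType) (P : fdist R S)
  (p : S -> fdist R T) : fdist R T := FDist (mixture_ge0 P p) (mixture_sum1 P p).

Lemma Expect_mixture (R : realType) (S T : finType) (P : fdist R S)
    (p : S -> fdist R T) f :
  Expect (mixture P p) f = Expect P (fun s => Expect (p s) f).
Proof.
transitivity (\sum_x \sum_s P s * (p s x * f x)).
  apply: eq_bigr => x _; rewrite mulr_suml.
  by apply: eq_bigr => s _; rewrite mulrA.
by rewrite exchange_big; apply: eq_bigr => s _; rewrite mulr_sumr.
Qed.

Section Dirac.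
Variables (R : realType) (T : finType) (x : T).

Lemma dirac_ge0 y : 0 <= (y == x)%:R :> R.
Proof. exact: ler0n. Qed.

Lemma dirac_sum1 : \sum_y (y == x)%:R = 1 :> R.
Proof. by rewrite (bigD1 x) //= eqxx big1 ?addr0 // => y /negPf ->. Qed.

Definition dirac : fdist R T := FDist dirac_ge0 dirac_sum1.

Lemma Expect_dirac f : Expect dirac f = f x.
Proof.
rewrite /Expect (bigD1 x) //= eqxx mul1r big1 ?addr0 // => y /negPf ->.
by rewrite mul0r.
Qed.

End Dirac.

Section UniformChoice.
Variables (R : realType) (S : finType) (hS : (0 < #|S|)%N).

Let card_neq0 : #|S|%:R != 0 :> R.
Proof. by rewrite pnatr_eq0 -lt0n. Qed.

Lemma uniform_ge0 (s : S) : 0 <= #|S|%:R^-1 :> R.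
Proof. by rewrite invr_ge0. Qed.

Lemma uniform_sum1 : \sum_(s : S) #|S|%:R^-1 = 1 :> R.
Proof. by rewrite sumr_const -[LHS]mulr_natl divff. Qed.

Definition uniform : fdist R S := FDist uniform_ge0 uniform_sum1.

Lemma le_mixture_uniform (T : finType) (p : S -> fdist R T) s x :
  p s x <= #|S|%:R * mixture uniform p x.
Proof.
rewrite /= /mixture_fun /Expect /= -mulr_sumr mulVKf // (bigD1 s) //= lerDl.
by apply: sumr_ge0 => *; apply: fdist_ge0.
Qed.

(** Change of measure: an average over the mixture controls each single [p s] at the price of a
    factor [#|S|]. *)
Lemma le_Expect_uniform (T : finType) (p : S -> fdist R T) s (f : T -> R) :
  (forall x, 0 <= f x) ->
  Expect (p s) f <= #|S|%:R * Expect (mixture uniform p) f.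
Proof.
move=> f0; rewrite mulr_sumr; apply: ler_sum => x _.
by rewrite mulrA ler_wpM2r ?le_mixture_uniform.
Qed.

Lemma mixture_uniform_neq0 (T : finType) (p : S -> fdist R T) s x :
  p s x != 0 -> mixture uniform p x != 0.
Proof.
move=> px; rewrite gt_eqF // -(pmulr_rgt0 _ (_ : 0 < #|S|%:R)) ?ltr0n //.
by apply: lt_le_trans (le_mixture_uniform p s x); rewrite lt0r px fdist_ge0.
Qed.

End UniformChoice.

(** * The one-round inequality *)

Section OneStep.
Variables (R : realType) (A B S : finType) (hS : (0 < #|S|)%N).
Variables (p : S -> fdist R (A * B)%type).
Hypothesis psi_eq0 : forall psi : component p -> R,
  (forall s, Expect (p s) (fun o => psi (common_data p o)) = 0) ->
  forall c, psi c = 0.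

Local Notation P := (mixture (uniform R hS) p).

(** Later [x a] and [y b] are the conditional probabilities, given the first outcome, that Alice's
    and Bob's bits are 1. *)
Definition mid (x : A -> R) (y : B -> R) (o : A * B) := 2^-1 * (x o.1 + y o.2).
Definition gap (x : A -> R) (y : B -> R) (o : A * B) := x o.1 - y o.2.

Lemma mixture_edge o : P o != 0 -> edge p (inl o.1) (inr o.2).
Proof.
case: o => a b Po; apply: contraNT Po; rewrite /edge negb_exists => /forallP p0.
rewrite /= /mixture_fun /Expect big1 // => s _; apply/eqP.
by rewrite mulf_eq0; apply/orP; right; rewrite eq_le fdist_ge0 andbT leNgt p0.
Qed.

(* Shifting x by -D/2 and y by D/2 makes them agree along every edge, hence on
   every component. *)
Lemma mid_const x y m D :
  (forall s, Expect (p s) (mid x y) = m) ->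
  (forall s o, p s o != 0 -> gap x y o = D) ->
  forall s o, p s o != 0 -> mid x y o = m.
Proof.
move=> Emid gapD s o po.
pose phi (v : A + B) :=
  match v with inl a => x a - D / 2 | inr b => y b + D / 2 end.
have phi_edge u v : edge p u v -> phi u = phi v.
  by case: u v => [a|b] [a'|b'] //= /existsP[t]; rewrite lt0r => /andP[pt _];
    have := gapD _ _ pt; rewrite /gap /=; lra.
have phi_connect u v : connect (edge p) u v -> phi u = phi v.
  case/connectP => q; elim: q u => [|w q IHq] u /= => [_ ->//|/andP[uw wq] vE].
  by rewrite (phi_edge _ _ uw); apply: IHq.
have phi_mid t o' : p t o' != 0 -> phi (inl o'.1) = mid x y o'.
  by move=> /gapD; rewrite /gap /mid /=; lra.
(* Any representative [v] will do, as [phi] is constant on components; the default [0] is never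
   reached, as a component contains the vertex it is built from. *)
pose psi (c : component p) : R :=
  if [pick v in val c] is Some v then phi v - m else 0.
have psiE o' : psi (common_data p o') = phi (inl o'.1) - m.
  rewrite /psi; case: pickP => [v|/(_ (inl o'.1))]; last by rewrite inE connect0.
  by rewrite inE => /phi_connect ->.
rewrite -(phi_mid s) //; apply/eqP; rewrite -subr_eq0 -psiE; apply/eqP.
(* Almost surely under [p t], [psi] of the common data is [mid x y - m], which has mean zero. *)
apply: psi_eq0 => t; rewrite -[RHS](subrr m) -[X in X - _](Emid t).
rewrite -[X in _ - X](Expect_cst (p t)) -[- Expect _ _]mulN1r -ExpectZ -ExpectD.
by apply: eq_Expect => o' po'; rewrite psiE (phi_mid t) // mulN1r.
Qed.

(** By [mid_const], the deviation of [mid] at [o] vanishes as soon as the mean differences and the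
    gap deviations do. All are linear in the pair [(x, y)], so the deviation is a combination of
    them, and [C] is the sum of the absolute coefficients. *)
Lemma dev_bound_at o : P o != 0 ->
  exists C, 0 <= C /\ forall (x : A -> R) (y : B -> R),
  `|mid x y o - Expect P (mid x y)| <=
  C * (\sum_s `|Expect (p s) (mid x y) - Expect P (mid x y)| +
       Expect P (fun o' => `|gap x y o' - Expect P (gap x y)|)).
Proof.
move=> Po.
pose V := ({ffun A -> R^o} * {ffun B -> R^o})%type.
have mid_lin o' : scalar (fun z : V => mid z.1 z.2 o').
  by move=> k z1 z2; rewrite /mid /= !ffunE /GRing.scale /=; ring.
have gap_lin o' : scalar (fun z : V => gap z.1 z.2 o').
  by move=> k z1 z2; rewrite /gap /= !ffunE /GRing.scale /=; ring.
have Elin (Q : fdist R (A * B)%type) (f : V -> A * B -> R) :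
    (forall o', scalar (f^~ o')) -> scalar (fun z => Expect Q (f z)).
  move=> flin k z1 z2; rewrite -ExpectZ -ExpectD.
  by apply: eq_Expect => o' _; rewrite flin.
(* The weight [P o'] makes the absolute values sum to an expectation; it loses gap information only
   off the support, where [mid_const] asks for none. *)
pose F (j : S + A * B) (z : V) : R := match j with
  | inl s => Expect (p s) (mid z.1 z.2) - Expect P (mid z.1 z.2)
  | inr o' => P o' * (gap z.1 z.2 o' - Expect P (gap z.1 z.2)) end.
have [||z Fz0|c cE] := @scalar_comb_of_ker R V _ F
    (fun z => mid z.1 z.2 o - Expect P (mid z.1 z.2)).
- move=> [s|o'] k z1 z2 /=.
    by rewrite !(Elin _ _ mid_lin); ring.
  by rewrite (Elin _ _ gap_lin) gap_lin; ring.
- by move=> k z1 z2; rewrite (Elin _ _ mid_lin) mid_lin; ring.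
- have [s po] : exists s, p s o != 0.
    apply/existsP; apply: contraNT Po; rewrite negb_exists => /forallP p0.
    rewrite /= /mixture_fun /Expect big1 // => s _.
    by move/negbNE/eqP: (p0 s) => ->; rewrite mulr0.
  apply/eqP; rewrite subr_eq0; apply/eqP.
  apply: (mid_const (D := Expect P (gap z.1 z.2)) _ _ po) => [t|t o' pt].
    by apply/eqP; rewrite -subr_eq0; apply/eqP; apply: (Fz0 (inl t)).
  have /eqP := Fz0 (inr o'); rewrite mulf_eq0.
  by rewrite (negPf (mixture_uniform_neq0 hS pt)) subr_eq0 => /eqP.
exists (\sum_j `|c j|); split; first by apply: sumr_ge0.
move=> x y; pose z : V := ([ffun a => x a], [ffun b => y b]).
have zmid o' : mid x y o' = mid z.1 z.2 o' by rewrite /mid !ffunE.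
have zgap o' : gap x y o' = gap z.1 z.2 o' by rewrite /gap !ffunE.
have Emid Q : Expect Q (mid x y) = Expect Q (mid z.1 z.2).
  by apply: eq_Expect => o' _; rewrite ?zmid ?zgap.
have Egap Q : Expect Q (gap x y) = Expect Q (gap z.1 z.2).
  by apply: eq_Expect => o' _; rewrite ?zmid ?zgap.
have -> : \sum_s `|Expect (p s) (mid x y) - Expect P (mid x y)| +
    Expect P (fun o' => `|gap x y o' - Expect P (gap x y)|) = \sum_j `|F j z|.
  rewrite big_sumType; congr (_ + _).
    by apply: eq_bigr => s _; rewrite !Emid.
  rewrite {1}/Expect; apply: eq_bigr => o' _.
  by rewrite /F Egap zgap normrM (ger0_norm (fdist_ge0 _ _)).
rewrite Emid zmid cE; apply: le_trans (ler_norm_sum _ _ _) _.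
rewrite mulr_suml; apply: ler_sum => j _; rewrite normrM ler_wpM2l //.
by rewrite (bigD1 j) //= lerDl sumr_ge0.
Qed.

Lemma dev_bound : exists C, 0 <= C /\ forall x y o, P o != 0 ->
  `|mid x y o - Expect P (mid x y)| <=
  C * (\sum_s `|Expect (p s) (mid x y) - Expect P (mid x y)| +
       Expect P (fun o' => `|gap x y o' - Expect P (gap x y)|)).
Proof.
have /fin_all_exists[C CP] : forall o,
    exists C, 0 <= C /\ (P o != 0 -> forall (x : A -> R) (y : B -> R),
  `|mid x y o - Expect P (mid x y)| <=
  C * (\sum_s `|Expect (p s) (mid x y) - Expect P (mid x y)| +
       Expect P (fun o' => `|gap x y o' - Expect P (gap x y)|))).
  move=> o; have [Po0|/dev_bound_at[C [C0 CP]]] := eqVneq (P o) 0; last by exists C.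
  by exists 0; split=> //; rewrite Po0 eqxx.
exists (\sum_o C o); split; first by apply: sumr_ge0 => o _; case: (CP o).
move=> x y o Po; apply: le_trans ((CP o).2 Po x y) _; apply: ler_wpM2r.
  by apply: addr_ge0; [apply: sumr_ge0 | apply: Expect_ge0].
by rewrite (bigD1 o) //= lerDl sumr_ge0 // => o' _; case: (CP o').
Qed.

(** This is [u + k u (1 - u) + K (x - y)^2], expanded so that its expectation is read off from the
    first and second moments of [mid] and [gap]. *)
Definition potential (k K x y : R) : R :=
  let u := 2^-1 * (x + y) in (1 + k) * u - k * u ^+ 2 + K * (x - y) ^+ 2.

Lemma Expect_potential (Q : fdist R (A * B)%type) k K x y :
  Expect Q (fun o => potential k K (x o.1) (y o.2)) =
  (1 + k) * Expect Q (mid x y) - k * Expect Q (fun o => mid x y o ^+ 2) +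
  K * Expect Q (fun o => gap x y o ^+ 2).
Proof.
by rewrite -mulNr -!ExpectZ -!ExpectD; apply: eq_Expect => o _; rewrite mulNr.
Qed.

Lemma potential_Expect (Q : fdist R (A * B)%type) k K x y :
  potential k K (Expect Q (fun o => x o.1)) (Expect Q (fun o => y o.2)) =
  (1 + k) * Expect Q (mid x y) - k * Expect Q (mid x y) ^+ 2 +
  K * Expect Q (gap x y) ^+ 2.
Proof.
have -> : Expect Q (mid x y) =
    2^-1 * (Expect Q (fun o => x o.1) + Expect Q (fun o => y o.2)).
  by rewrite -ExpectD -ExpectZ.
have -> // : Expect Q (gap x y) =
    Expect Q (fun o => x o.1) - Expect Q (fun o => y o.2).
by rewrite -mulN1r -ExpectZ -ExpectD; apply: eq_Expect => o _; rewrite mulN1r.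
Qed.

Lemma potential_step : exists k K, [/\ 0 < k, 0 <= K &
  forall (x : A -> R) (y : B -> R),
  (forall a, 0 <= x a <= 1) -> (forall b, 0 <= y b <= 1) ->
  exists s, potential k K (Expect P (fun o => x o.1)) (Expect P (fun o => y o.2))
    <= Expect (p s) (fun o => potential k K (x o.1) (y o.2))].
Proof.
have [C [C0 dev]] := dev_bound.
pose N : R := #|S|%:R.
have N0 : 0 <= N by apply: ler0n.
(* With [t s] the largest excess mean and [W] the mean gap deviation, [mid] deviates by at most [G]
   times the larger of the two. The choice [K = G^2 k] settles the case where [W] dominates, and
   [den] the other. *)
pose G := C * (2 * N + 1).
have G0 : 0 <= G by rewrite mulr_ge0 // addr_ge0 ?mulr_ge0.
pose den := 1 + G ^+ 2 + 2 * G ^+ 2 * N.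
have den0 : 0 < den.
  have := mulr_ge0 (sqr_ge0 G) N0; have := sqr_ge0 G; rewrite /den; lra.
pose k := den^-1; have k0 : 0 < k by rewrite invr_gt0.
have kden : k * den = 1 by rewrite mulVf ?gt_eqF.
exists k, (G ^+ 2 * k); have K0 : 0 <= G ^+ 2 * k by rewrite mulr_ge0 ?sqr_ge0 ?ltW.
split=> // x y x01 y01.
set U := Expect P (mid x y); set D := Expect P (gap x y).
set W := Expect P (fun o => `|gap x y o - D|).
have mid01 o : 0 <= mid x y o <= 1.
  by have := x01 o.1; have := y01 o.2; rewrite /mid; lra.
have gap1 o : `|gap x y o| <= 1.
  by rewrite ler_norml; have := x01 o.1; have := y01 o.2; rewrite /gap; lra.
have Emid01 Q : 0 <= Expect Q (mid x y) <= 1.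
  rewrite Expect_ge0 => [|o]; last by case/andP: (mid01 o).
  by rewrite -[leRHS](Expect_cst Q); apply: Expect_le => o _; case/andP: (mid01 o).
have D1 : `|D| <= 1.
  apply: le_trans (normr_Expect _ _) _; rewrite -[leRHS](Expect_cst P).
  exact: Expect_le.
pose t s := Expect (p s) (mid x y) - U.
have [s tmax] : exists s, forall s', t s' <= t s by apply: exists_max.
have sumt : \sum_s' t s' = 0.
  have : Expect (uniform R hS) t = 0.
    rewrite /t ExpectD Expect_cst -Expect_mixture; exact: subrr.
  rewrite /Expect -mulr_sumr => /eqP; rewrite mulf_eq0 invr_eq0 pnatr_eq0.
  by rewrite -[_ == 0%N]negbK -lt0n hS => /eqP.
have t0 : 0 <= t s.
  have [s' ?] := exists_ge_Expect (uniform R hS) t; apply: le_trans (tmax s').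
  by apply: le_trans (_ : Expect (uniform R hS) t <= _);
    rewrite // /Expect -mulr_sumr sumt mulr0.
have sum_abs : \sum_s' `|t s'| <= 2 * N * t s.
  (* Adding the null sum of the [t s'] turns each term into [|t s'| + t s'], at most twice the
     maximum [t s]. *)
  rewrite -[leLHS]addr0 -{2}sumt -big_split /=.
  have -> : 2 * N * t s = \sum_(s' : S) 2 * t s.
    by rewrite sumr_const -[RHS]mulr_natl mulrCA mulrA.
  apply: ler_sum => s' _; have := tmax s'.
  by case: (ler0P (t s')); lra.
have W0 : 0 <= W by apply: Expect_ge0.
have dev_le M o : W <= M -> t s <= M -> P o != 0 ->
    (mid x y o - U) ^+ 2 <= G ^+ 2 * M ^+ 2.
  move=> WM tM Po; have M0 := le_trans W0 WM.
  have dM : `|mid x y o - U| <= G * M.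
    apply: le_trans (dev x y o Po) _; rewrite -mulrA; apply: ler_wpM2l => //.
    rewrite mulrDl mul1r lerD //; apply: le_trans sum_abs _.
    by rewrite ler_wpM2l ?mulr_ge0.
  rewrite -real_normK ?num_real // -exprMn.
  have GM0 := mulr_ge0 G0 M0.
  by rewrite ler_sqr ?nnegrE.
(* If [W] dominates, the variance of the gap pays on average over the uniform choice, hence for some
   [s']. Otherwise the maximiser [s] works, its excess [t s] paying for everything. *)
rewrite potential_Expect -/U -/D; have [tW|Wt] := leP (t s) W.
  have [s' le_s'] := exists_ge_Expect (uniform R hS)
    (fun s' => Expect (p s') (fun o => potential k (G ^+ 2 * k) (x o.1) (y o.2))).
  exists s'; apply: le_trans le_s'; rewrite -Expect_mixture Expect_potential.
  rewrite (Expect_sqr_dev P (mid x y) U) (Expect_sqr_dev P (gap x y) D) -/U -/D.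
  have v1 : Expect P (fun o => (mid x y o - U) ^+ 2) <= G ^+ 2 * W ^+ 2.
    by rewrite -[leRHS](Expect_cst P); apply: Expect_le => o; apply: dev_le.
  have v2 : W ^+ 2 <= Expect P (fun o => (gap x y o - D) ^+ 2).
    apply: le_trans (Expect_sqr_ge _ _) _; apply: Expect_le => o _.
    by rewrite real_normK ?num_real.
  have := ler_wpM2l (ltW k0) v1; have := ler_wpM2l K0 v2; lra.
exists s; rewrite Expect_potential (Expect_sqr_dev (p s) (mid x y) U).
have -> : Expect (p s) (mid x y) = U + t s by rewrite /t; ring.
set v := Expect _ _; set g2 := Expect (p s) _.
have t1 : t s <= 1 by have := Emid01 (p s); have := Emid01 P; rewrite /t -/U; lra.
(* The quadratic bound becomes linear in [t s] because [t s <= 1]. *)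
have v_le : v <= G ^+ 2 * t s.
  apply: le_trans (_ : G ^+ 2 * t s ^+ 2 <= _).
    rewrite -[leRHS](Expect_cst (p s)); apply: Expect_le => o po.
    by apply: dev_le; rewrite ?(ltW Wt) // (mixture_uniform_neq0 hS po).
  by rewrite ler_wpM2l ?sqr_ge0 // expr2 ler_piMl.
(* With [e] the mean gap under [p s], [e^2 >= D^2 + 2 D (e - D)], and [|e - D| <= N W] by change of
   measure. *)
have g2_ge : D ^+ 2 - 2 * N * t s <= g2.
  apply: le_trans (Expect_sqr_ge _ _); set e := Expect _ _.
  have De : `|D * (e - D)| <= N * t s.
    rewrite normrM -[leRHS]mul1r; apply: ler_pM => //.
    have -> : e - D = Expect (p s) (fun o => gap x y o - D).
      by rewrite ExpectD Expect_cst.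
    apply: le_trans (normr_Expect _ _) _.
    apply: le_trans (le_Expect_uniform hS p s _) _ => //.
    by rewrite ler_wpM2l // ltW.
  have := ler_norml (D * (e - D)) (N * t s); rewrite De => /esym/andP[De1 _].
  by have := sqr_ge0 (e - D); rewrite !expr2 in De1 *; lra.
have h1 : 0 <= k * (t s * (1 - U)).
  by rewrite !mulr_ge0 ?(ltW k0) // subr_ge0; case/andP: (Emid01 P).
have h2 := ler_wpM2l (ltW k0) v_le.
have h3 := ler_wpM2l K0 g2_ge.
(* The three terms of [den] pay in turn for the excess of the cross term [2 k U t s] over the gain
   [k t s] (with [h1]), for [k v], and for the drop in the squared gap. *)
have h4 : t s = k * den * t s by rewrite kden mul1r.
rewrite /den in h4; lra.
Qed.

End OneStep.

(** * Recursion over rounds and construction of the adversary *)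

Section Source.
Variables (R : realType) (A B S : finType) (p : S -> fdist R (A * B)%type).

Lemma Expect_source0 q F : Expect (source_law p q 0) F = F [tuple].
Proof.
rewrite /Expect (big_pred1 [tuple]) => [|w]; last by apply/esym/eqP; exact: tuple0.
by rewrite /= /path_weight big_ord0 mul1r.
Qed.

(** Conditioning on the first round: after outcome [o], what remains is a source driven by the
    strategy with [o] put in front of every history. *)
Lemma Expect_sourceS q n F :
  Expect (source_law p q n.+1) F =
  Expect (q [::]) (fun s => Expect (p s) (fun o =>
    Expect (source_law p (fun h => q (o :: h)) n) (fun w => F [tuple of (s, o) :: w]))).
Proof.
pose cons_t (xw : (S * (A * B)) * n.-tuple (S * (A * B))) :=
  [tuple of xw.1 :: xw.2].
pose uncons_t (w : n.+1.-tuple (S * (A * B))) := (thead w, behead_tuple w).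
rewrite /Expect (reindex cons_t) /=; last first.
  apply: onW_bij; exists uncons_t => [[x w]|w].
    by congr pair; apply: val_inj.
  by rewrite [RHS]tuple_eta; apply: val_inj.
rewrite -(pair_bigA _ (fun x w =>
  path_weight p q [::] (cons_t (x, w)) * F (cons_t (x, w)))) /=.
transitivity (\sum_s \sum_o \sum_w
    path_weight p q [::] (cons_t (s, o, w)) * F (cons_t (s, o, w))).
  by rewrite [RHS]pair_bigA; apply: eq_bigr => -[s o].
apply: eq_bigr => s _; rewrite mulr_sumr; apply: eq_bigr => o _.
rewrite !mulr_sumr; apply: eq_bigr => w _.
by rewrite path_weight_cons /= -!mulrA.
Qed.

End Source.

Lemma adversary_beats_potential (R : realType) (A B S : finType)
    (hS : (0 < #|S|)%N) (p : S -> fdist R (A * B)%type) (k K : R) :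
    0 <= k -> 0 <= K ->
    (forall (x : A -> R) (y : B -> R),
      (forall a, 0 <= x a <= 1) -> (forall b, 0 <= y b <= 1) ->
      exists s, potential k K (Expect (mixture (uniform R hS) p) (fun o => x o.1))
          (Expect (mixture (uniform R hS) p) (fun o => y o.2))
        <= Expect (p s) (fun o => potential k K (x o.1) (y o.2))) ->
  forall n (f : n.-tuple A -> bool) (g : n.-tuple B -> bool),
  exists q : strategy R A B S,
    potential k K
      (Expect (source_law p (fun=> uniform R hS) n) (fun w => (f (alice_view w))%:R))
      (Expect (source_law p (fun=> uniform R hS) n) (fun w => (g (bob_view w))%:R))
    <= Expect (source_law p q n) (fun w =>
         2^-1 * ((f (alice_view w))%:R + (g (bob_view w))%:R) +
         (k + K) * (f (alice_view w) != g (bob_view w))%:R).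
Proof.
move=> k0 K0 step; elim=> [|n IHn] f g.
  (* With no rounds both bits are constants: equality if they agree, and [k / 4 + K <= k + K] if
     they differ. *)
  exists (fun=> uniform R hS); rewrite !Expect_source0 /potential !expr2.
  by case: (f _); case: (g _) => /=; lra.
pose f' a (v : n.-tuple A) := f [tuple of a :: v].
pose g' b (v : n.-tuple B) := g [tuple of b :: v].
pose u : strategy R A B S := fun=> uniform R hS.
(* Under uniform choices the later rounds ignore the first outcome, so the conditional probability
   for Alice depends on [a] alone, and Bob's on [b] alone. *)
pose x a := Expect (source_law p u n) (fun w => (f' a (alice_view w))%:R).
pose y b := Expect (source_law p u n) (fun w => (g' b (bob_view w))%:R).
have fE s o (w : n.-tuple (S * (A * B))) :
    f (alice_view [tuple of (s, o) :: w]) = f' o.1 (alice_view w).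
  by congr f; apply: val_inj.
have gE s o (w : n.-tuple (S * (A * B))) :
    g (bob_view [tuple of (s, o) :: w]) = g' o.2 (bob_view w).
  by congr g; apply: val_inj.
have E01 (c : n.-tuple (S * (A * B)) -> bool) :
    0 <= Expect (source_law p u n) (fun w => (c w)%:R) <= 1.
  rewrite Expect_ge0 // -[leRHS](Expect_cst (source_law p u n)).
  by apply: Expect_le => w _; rewrite lern1 leq_b1.
have /fin_all_exists[q qP] := fun o : A * B => IHn (f' o.1) (g' o.2).
have [s sP] := step x y (fun a => E01 _) (fun b => E01 _).
(* The adversary plays the [s] of the one-round inequality first, then the inductive strategy
   attached to the observed outcome. *)
exists (fun h => if h is o :: h' then q o h' else dirac R s).
apply: le_trans (_ : Expect (p s) (fun o => potential k K (x o.1) (y o.2)) <= _).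
  apply: le_trans sP; rewrite !Expect_sourceS !Expect_mixture le_eqVlt.
  apply/orP; left; apply/eqP; congr potential.
    apply: eq_Expect => s' _; apply: eq_Expect => o _; apply: eq_Expect => w _.
    by rewrite fE.
  apply: eq_Expect => s' _; apply: eq_Expect => o _; apply: eq_Expect => w _.
  by rewrite gE.
rewrite Expect_sourceS Expect_dirac; apply: Expect_le => o _.
apply: le_trans (qP o) _; rewrite le_eqVlt; apply/orP; left; apply/eqP.
by apply: eq_Expect => w _; rewrite fE gE.
Qed.

(** * The contradiction with extraction *)

Lemma Pr_Expect (R : realType) (T : finType) (P : fdist R T) (E : pred T) :
  Pr P E = Expect P (fun w => (E w)%:R).
Proof.
rewrite /Pr /Expect big_mkcond; apply: eq_bigr => w _.
by case: (E w); rewrite ?mulr1 ?mulr0.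
Qed.

(** Only the term at [true] of the total variation sum is kept, so the prefactor one half becomes a
    harmless factor 2. *)
Lemma bias_le_tv_dist (R : realType) (T : finType) (P : fdist R T)
    (X : T -> bool) e :
  tv_dist (law P X) (uniform_bit R) <= e ->
  `|Expect P (fun w => (X w)%:R) - 2^-1| <= 2 * e.
Proof.
rewrite /tv_dist big_bool /= /law /uniform_bit !Pr_Expect => tv_le.
have -> : Expect P (fun w => (X w)%:R) = Expect P (fun w => (X w == true)%:R).
  by apply: eq_Expect => w _; rewrite eqb_id.
have := normr_ge0 (Expect P (fun w => (X w == false)%:R) - 2^-1); lra.
Qed.

Theorem theorem4 (R : realType) (A B S : finType) (hS : (0 < #|S|)%N)
  (p : S -> fdist R (A * B)%type)
  (hp : ~ exists psi : component p -> R,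
      (exists c, psi c != 0) /\
      (forall s, Expect (p s) (fun o => psi (common_data p o)) = 0)) :
  ~ common_randomness_extractable p.
Proof.
have psi_eq0 (psi : component p -> R) :
    (forall s, Expect (p s) (fun o => psi (common_data p o)) = 0) ->
    forall c, psi c = 0.
  move=> Epsi c; have [//|psic] := eqVneq (psi c) 0.
  by case: hp; exists psi; split=> //; exists c.
have [k [K [k0 K0 step]]] := potential_step hS psi_eq0.
(* The estimates below give [k / 4 <= (4 + 3 k + K) e]; the factor 8 makes the right side
   [k / 8]. *)
pose den := 8 * (4 + 3 * k + K); have den0 : 0 < den by rewrite /den; lra.
pose e := k / den; have e0 : 0 < e by rewrite divr_gt0.
have eden : e * den = k by rewrite divfK ?gt_eqF.
have e1 : 2 * e <= 1.
  suff : e <= 24^-1 by lra.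
  by rewrite ler_pdivrMr // /den; lra.
move/(_ e e0) => [n [f [g ext]]].
have [q qP] := adversary_beats_potential (ltW k0) K0 step f g.
(* Uniform choices place [u] near one half; the strategy [q] bounds the bias and disagreement on the
   other side of [qP]. *)
have [/bias_le_tv_dist + /bias_le_tv_dist + _] := ext (fun=> uniform R hS).
have [/bias_le_tv_dist + /bias_le_tv_dist + /ltW] := ext q.
rewrite Pr_Expect; move: qP; rewrite !(ExpectD, ExpectZ) /potential.
set x := Expect _ _; set y := Expect _ _; set x' := Expect _ _.
set y' := Expect _ _; set z := Expect _ _.
set u := _^-1 * (x + y) => qP.
rewrite !ler_norml => /andP[_ x'e] /andP[_ y'e] ze /andP[x1 x2] /andP[y1 y2].
have u1 : - (2 * e) <= u - 2^-1 by rewrite /u; lra.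
have u2 : u - 2^-1 <= 2 * e by rewrite /u; lra.
have u_sqr : (u - 2^-1) ^+ 2 <= 2 * e.
  apply: le_trans (_ : (2 * e) ^+ 2 <= _); last by rewrite expr2 ler_piMl; lra.
  have : 0 <= (2 * e - (u - 2^-1)) * (2 * e + (u - 2^-1)) by apply: mulr_ge0; lra.
  by rewrite !expr2; lra.
have h1 := ler_wpM2l (ltW k0) u_sqr.
have h2 := mulr_ge0 K0 (sqr_ge0 (x - y)).
have h3 : (k + K) * z <= (k + K) * e by apply: ler_wpM2l => //; lra.
rewrite /den in eden; lra.
Qed.
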